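(* Let $A$ be a finite nonempty alphabet, let $S\subset A^*$ be an acyclic set, let $X\subset S$ be a finite bifix code and let $f:B^*\to A^*$ be a coding morphism for $X$. If the bifix decoding $f^{-1}(S)\subset B^*$ is biextendable, then $f^{-1}(S)$ is acyclic.
   Context: A set $T$ of words is factorial if it contains all factors of its elements. For $w\in T$: $L(w)$, $R(w)$ are the sets of letters $a$ with $aw\in T$, resp. $wa\in T$, and $E(w)=\{(a,b)\mid awb\in T\}$; $T$ is biextendable if factorial and $E(w)\ne\emptyset$ for all $w\in T$. The extension graph of $w$ is the undirected bipartite graph with vertex set the disjoint union of $L(w)$ and $R(w)$ and an edge $a$–$b$ for each $(a,b)\in E(w)$; $T$ is acyclic if biextendable and all extension graphs are acyclic. A bifix code is a set of nonempty words containing no proper prefix and no proper suffix of its elements. A coding morphism for $X$ is a monoid morphism $f:B^*\to A^*$ ($B$ an alphabet) mapping $B$ bijectively onto $X$; $f^{-1}(S)$ is called a bifix decoding of $S$. *)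

(* Defs.v *)
From mathcomp Require Import all_boot.
From mathcomp Require Import boolp classical_sets functions cardinality.

Set Implicit Arguments.
Unset Strict Implicit.
Unset Printing Implicit Defensive.

Local Open Scope classical_set_scope.

Section Extensions.
Variable A : finType.
Implicit Types (T : set (seq A)) (w : seq A).

Definition factorial_set T : Prop := forall u w, T w -> infix u w -> T u.

Definition left_ext T w : set A := [set a | T (a :: w)].
Definition right_ext T w : set A := [set a | T (rcons w a)].
Definition bi_ext T w : set (A * A) := [set ab | T (ab.1 :: rcons w ab.2)].

Definition biextendable T : Prop :=
  factorial_set T /\ forall w, T w -> bi_ext T w !=set0.

(* [inl] and [inr] tag the two copies in the disjoint union of [left_ext T w]
   and [right_ext T w]: a letter may occur in both. *)
Definition ext_vertex T w : set (A + A) :=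
  [set v | match v with
           | inl a => left_ext T w a
           | inr b => right_ext T w b
           end].

Definition ext_edge T w (u v : A + A) : Prop :=
  match u, v with
  | inl a, inr b | inr b, inl a => bi_ext T w (a, b)
  | _, _ => False
  end.

End Extensions.

(* The bound on the size excludes the closed walk that follows one edge back
   and forth. *)
Definition acyclic_graph (V : eqType) (D : set V) (e : V -> V -> Prop) : Prop :=
  ~ exists c : seq V,
      [/\ [set` c] `<=` D, uniq c, 2 < size c & cycle (fun u v => `[< e u v >]) c].

Definition acyclic_set (A : finType) (T : set (seq A)) : Prop :=
  biextendable T /\
  forall w, T w -> acyclic_graph (ext_vertex T w) (ext_edge T w).

Definition bifix_code (A : finType) (X : set (seq A)) : Prop :=
  [/\ ~ X [::],
      forall x y, X x -> X y -> prefix x y -> x = y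
    & forall x y, X x -> X y -> suffix x y -> x = y].

Definition word_morphism (A B : finType) (f : seq B -> seq A) : Prop :=
  f [::] = [::] /\ forall u v, f (u ++ v) = f u ++ f v.

Definition coding_morphism (A B : finType) (X : set (seq A))
    (f : seq B -> seq A) : Prop :=
  word_morphism f /\ set_bij [set: B] X (fun b => f [:: b]).

(* Main.v *)
Require Import Defs.
From mathcomp Require Import all_boot.
From mathcomp Require Import boolp classical_sets functions cardinality.
From mathcomp Require Import ssralg ssrint.

(** A bipartite graph on [I + I] is a forest iff it carries no nonzero
    circulation, i.e. no nonzero integer weight [phi i j] supported on its edges
    whose row and column sums all vanish.  Let [phi] be a circulation on the
    extension graph of [w] in the decoding, and let [Phi p q] be the sum of
    [phi x y] over the code words [x] with suffix [p] and [y] with prefix [q].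
    For fixed [p] and [q], [(a, b) |-> Phi (a p) (q b)] is supported on the
    extension graph of [p f(w) q] in [S].  As the code is bifix, its row and
    column sums are values of [Phi] at shorter words, or [0]; by induction they
    vanish, so it is a circulation on a forest, hence [0].  Finally
    [Phi x y = phi x y] for code words [x] and [y]. *)

Local Open Scope classical_set_scope.
Import GRing.Theory.

(** A simple path is prolonged at its head without turning back; as [V] is finite, some new head
    already lies on the path and closes a cycle. *)
Lemma exists_cycle (V : finType) (e : rel V) (u v : V) :
    symmetric e -> irreflexive e ->
    (forall x y, e x y -> exists2 z, e y z & z != x) -> e u v ->
  exists c, [/\ uniq c, 2 < size c & cycle e c].
Proof.
move=> symE irrE extE euv.
(* The path has [size p + 2] vertices, so [n = 0] would give more than [#|V|] of them. *)
suff H n x y p : #|V| <= n + size p -> path e x (y :: p) ->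
    uniq [:: x, y & p] -> exists c, [/\ uniq c, 2 < size c & cycle e c].
  apply: (H #|V| u v [::]); rewrite /= ?addn0 ?andbT ?euv // inE.
  by apply: contraTneq euv => ->; rewrite irrE.
elim: n x y p => [|n IHn] x y p leV pE uE.
  by have := max_card [in [:: x, y & p]]; rewrite (card_uniqP uE) /= leqNgt ltnS;
    rewrite (leq_trans leV) ?leqnSn.
have exy : e x y by case/andP: pE.
have [t ext tNy] : exists2 t, e x t & t != y by apply: extE; rewrite symE.
have tNx : t != x by apply: contraTneq ext => ->; rewrite irrE.
have [tp|tNp] := boolP (t \in p); last first.
  apply: (IHn t x (y :: p)); first by rewrite /= addnS -addSn.
    by rewrite /= symE ext.
  by rewrite cons_uniq uE !inE !negb_or tNx tNy tNp.
case/splitPr: tp => p1 p2 in pE uE {leV}.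
exists [:: x, y & rcons p1 t]; split.
- by move: uE; rewrite -cat_rcons -!cat_cons cat_uniq => /and3P[].
- by rewrite /= size_rcons.
- move: pE; rewrite -cat_rcons -cat_cons cat_path => /andP[pE _].
  by rewrite (cycle_path x) /= last_rcons symE ext.
Qed.

Lemma sum_neq_other (I : finType) (F : I -> int) i :
  (\sum_j F j = 0 -> F i != 0 -> exists2 j, F j != 0 & j != i)%R.
Proof.
move=> sF Fi; apply/exists_inP; apply: contraNT Fi => /exists_inPn F0.
rewrite -sF (bigD1 i) //= big1 ?addr0 // => j ji.
by apply/eqP; apply: contraTT ji => /F0.
Qed.

(** A zero sum cannot have exactly one nonzero term, so every edge in the support of a circulation
    can be continued past either end, and the support contains a cycle. *)
Lemma acyclic_no_circulation (A : finType) (T : set (seq A)) (w : seq A)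
    (psi : A -> A -> int) :
    factorial_set T -> acyclic_graph (ext_vertex T w) (ext_edge T w) ->
    (forall a b, psi a b != 0%R -> T (a :: rcons w b)) ->
    (forall a, \sum_b psi a b = 0)%R -> (forall b, \sum_a psi a b = 0)%R ->
  forall a b, psi a b = 0%R.
Proof.
move=> facT acT supp row col a b; apply/eqP/negP => /negP psi_ab; apply: acT.
pose e (u v : A + A) := match u, v with
  | inl a, inr b | inr b, inl a => psi a b != 0%R | _, _ => false end.
have eE u v : e u v -> ext_edge T w u v by case: u v => [c|c] [d|d] //= /supp.
have [||||c [uc sc ec]] := @exists_cycle _ e (inl a) (inr b) => //.
- by move=> [c|c] [d|d].
- by case.
- move=> [x|x] [y|y] //= exy.
  + have [z] := @sum_neq_other _ (psi^~ y) x (col y) exy.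
    by exists (inl z).
  + have [z] := @sum_neq_other _ (psi y) x (row y) exy.
    by exists (inr z).
exists c; split=> //; last first.
  by apply: sub_cycle ec => u v /eE ?; apply/asboolP.
move=> v /= /(next_cycle ec) /eE.
case: v (next c v) => [x|x] [y|y] //= Txy; apply: (facT _ _ Txy).
- by rewrite -rcons_cons -cats1; apply: prefix_infix; apply: prefix_prefix.
- by rewrite -cat1s; apply: suffix_infix; apply: suffix_suffix.
Qed.

(** On two vertices this fails, and the opposite signs put on a cycle below would cancel. *)
Lemma next_neq_prev (V : eqType) (c : seq V) (x : V) :
  uniq c -> 2 < size c -> x \in c -> next c x != prev c x.
Proof.
move=> uc sc xc; have [i c' cE] := rot_to xc.
rewrite -(next_rot i) // -(prev_rot i) //.
move: sc uc; rewrite -(size_rot i) -(rot_uniq i) cE.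
case: c' {cE} => [|y [|z s]] // _ /and3P[xN yN _].
have -> : prev [:: x, y, z & s] x = last z s.
  transitivity (nth x [:: x, y, z & s] (index x [:: y, z & s])).
    by rewrite prev_nth mem_head.
  by rewrite memNindex // (nth_last x [:: x, y, z & s]).
by rewrite /= eqxx; apply: contraNneq yN => ->; rewrite mem_last.
Qed.

Lemma no_circulation_acyclic (A : finType) (T : set (seq A)) (w : seq A) :
    (forall phi : A -> A -> int,
       (forall a b, phi a b != 0%R -> T (a :: rcons w b)) ->
       (forall a, \sum_b phi a b = 0)%R -> (forall b, \sum_a phi a b = 0)%R ->
     forall a b, phi a b = 0%R) ->
  acyclic_graph (ext_vertex T w) (ext_edge T w).
Proof.
move=> noT [c [_ uc sc ec]].
have edge_next x : x \in c -> ext_edge T w x (next c x).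
  by move=> /(next_cycle ec)/asboolP.
have edge_prev x : x \in c -> ext_edge T w (prev c x) x.
  by move=> /(prev_cycle ec)/asboolP.
(* Off [c], [next] and [prev] default to the identity, which never changes sides; no weight arises
   there. *)
have next_notin x : x \notin c -> next c x = x.
  by move=> xc; rewrite next_nth (negPf xc).
have prev_notin x : x \notin c -> prev c x = x.
  by move=> xc; rewrite prev_nth (negPf xc).
have next_prevE x y : (next c x == y) = (prev c y == x).
  by apply/eqP/eqP => <-; rewrite ?prev_next ?next_prev.
(* Orient the cycle: [+1] on its edges from left to right, [-1] on its edges
   from right to left. *)
pose phi a b : int :=
  ((next c (inl a) == inr b)%:R - (prev c (inl a) == inr b)%:R)%R.
have sum1 (P : pred A) x : P =1 pred1 x -> (\sum_b (P b)%:R = 1 :> int)%R.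
  move=> PE; rewrite (bigD1 x) //= PE /= eqxx big1 ?addr0 // => y yx.
  by rewrite PE /= (negPf yx).
have phi0 : forall a b, phi a b = 0%R.
  apply: noT => [a b|a|b].
  - rewrite /phi; have [nab|_] := eqVneq (next c (inl a)) (inr b).
      have [ac _|/next_notin] := boolP (inl a \in c); last by rewrite nab.
      by have := edge_next _ ac; rewrite nab.
    have [pab|_] := eqVneq (prev c (inl a)) (inr b); last by rewrite subrr eqxx.
    have [ac _|/prev_notin] := boolP (inl a \in c); last by rewrite pab.
    by have := edge_prev _ ac; rewrite pab.
  - rewrite sumrB; have [ac|ac] := boolP (inl a \in c); last first.
      by rewrite next_notin // prev_notin // !big1 ?subrr.
    have := edge_next _ ac; have := edge_prev _ ac.
    case: (prev c _) => [//|y] _; case: (next c _) => [//|x] _.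
    rewrite (sum1 _ x) ?(sum1 _ y) ?subrr // => z /=; exact: eq_sym.
  - rewrite sumrB.
    (* Both conditions are restated as conditions on the two neighbours of [inr b]. *)
    under eq_bigr do rewrite next_prevE.
    under [X in (_ - X)%R]eq_bigr do rewrite -next_prevE.
    have [bc|bc] := boolP (inr b \in c); last first.
      by rewrite next_notin // prev_notin // !big1 ?subrr.
    have := edge_next _ bc; have := edge_prev _ bc.
    case: (prev c _) => [y|//] _; case: (next c _) => [x|//] _.
    rewrite (sum1 _ y) ?(sum1 _ x) ?subrr // => z /=; exact: eq_sym.
(* Edges change sides, so [c] has a left vertex; its outgoing edge has weight 1. *)
have [a ac] : exists a, inl a \in c.
  have [v vc] : exists v, v \in c.
    by case: (c) sc => // v s _; exists v; rewrite mem_head.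
  case: v vc => [a|b] vc; first by exists a.
  have := edge_next _ vc; have := mem_next c (inr b); rewrite vc.
  by case: (next c _) => // a; exists a.
have := next_neq_prev _ _ _ uc sc ac; have := edge_next _ ac.
have := phi0 a; rewrite /phi; case: (next c _) => [//|b] /(_ b).
by rewrite eqxx eq_sym; case: eqP.
Qed.

(** If [p] is itself some [g i], no other [g j] extends it and all terms vanish. Otherwise each
    [g i] with prefix [p] has exactly one next letter, and the sum over [p] is merely regrouped. *)
Lemma sum_prefix_rcons (A I : finType) (g : I -> seq A) (F : I -> int) p :
    (forall i j, prefix (g i) (g j) -> i = j) ->
    (\sum_(i | prefix p (g i)) F i = 0)%R ->
  (\sum_a \sum_(i | prefix (rcons p a) (g i)) F i = 0)%R.
Proof.
move=> gI sF.
have prE a i : prefix (rcons p a) (g i) =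
    prefix p (g i) && (ohead (drop (size p) (g i)) == Some a).
  apply/prefixP/andP => [[s gE]|[/prefixP[s gE]]].
    by rewrite gE cat_rcons prefix_prefix drop_size_cat.
  rewrite gE drop_size_cat //; case: s gE => [|b s] //= _ /eqP[->].
  by exists s; rewrite cat_rcons.
rewrite (exchange_big_dep (fun i => prefix p (g i))) /=; last first.
  by move=> a i _; rewrite prE => /andP[].
have [/existsP[i0 /eqP pE]|/existsPn pN] := boolP [exists i, g i == p].
  rewrite big1 // => i pi; rewrite big1 // => a; rewrite prE.
  have <- : i0 = i by apply: gI; rewrite pE.
  by rewrite pE drop_size andbF.
rewrite -[RHS]sF; apply: eq_bigr => i pi.
have /prefixP[[|b s] gE] := pi; first by have := pN i; rewrite gE cats0 eqxx.
rewrite (big_pred1 b) // => a.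
by rewrite prE pi /= gE drop_size_cat //= eq_sym.
Qed.

Lemma bifix_no_circulation (A I : finType) (S : set (seq A)) (w : seq A)
    (g : I -> seq A) (phi : I -> I -> int) :
    acyclic_set S ->
    (forall i j, prefix (g i) (g j) -> i = j) ->
    (forall i j, suffix (g i) (g j) -> i = j) ->
    (forall i j, phi i j != 0%R -> S (g i ++ w ++ g j)) ->
    (forall i, \sum_j phi i j = 0)%R -> (forall j, \sum_i phi i j = 0)%R ->
  forall i j, phi i j = 0%R.
Proof.
move=> [[facS _] acS] gpre gsuf supp row col.
(* The first argument of [Phi] is a reversed suffix of a code word. *)
pose Phi p q := (\sum_(i | prefix p (rev (g i))) \sum_(j | prefix q (g j)) phi i j)%R.
have PhiC p q : Phi p q =
    (\sum_(j | prefix q (g j)) \sum_(i | prefix p (rev (g i))) phi i j)%R.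
  exact: exchange_big.
suff Phi0 n p q : size p + size q <= n -> Phi p q = 0%R.
  (* At full code words both sums have a single term, by the bifix property. *)
  move=> i j; rewrite -(Phi0 _ (rev (g i)) (g j) (leqnn _)) /Phi.
  rewrite (big_pred1 i) => [|k]; last first.
    by apply/idP/eqP => [/gsuf//|->]; rewrite prefix_refl.
  rewrite (big_pred1 j) // => k.
  by apply/idP/eqP => [/gpre//|->]; rewrite prefix_refl.
(* If [p] or [q] is empty, its sum is unrestricted and yields column or row sums of [phi]. *)
elim: n p q => [|n IHn] p q.
  rewrite leqn0 addn_eq0 => /andP[/nilP-> _].
  rewrite /Phi exchange_big big1 // => j _.
  by under eq_bigl do rewrite prefix0s.
case/lastP: p => [_|p a].
  rewrite /Phi exchange_big big1 // => j _.
  by under eq_bigl do rewrite prefix0s.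
case/lastP: q => [_|q b].
  rewrite /Phi big1 // => i _.
  by under eq_bigl do rewrite prefix0s.
rewrite !size_rcons addSn addnS ltnS => le_pq.
have suppPhi c d : Phi (rcons p c) (rcons q d) != 0%R ->
    S (c :: rcons (rev p ++ w ++ q) d).
  move=> Phi_cd.
  have [i pi [j pj /supp Sij]] : exists2 i, prefix (rcons p c) (rev (g i)) &
      exists2 j, prefix (rcons q d) (g j) & phi i j != 0%R.
    apply: contrapT => noij; move/eqP: Phi_cd; apply.
    apply: big1 => i pi; apply: big1 => j qj; apply: contrapT => /eqP ij.
    by apply: noij; exists i => //; exists j.
  apply: (facS _ _ Sij).
  have /suffixP[s ->] : suffix (c :: rev p) (g i) by rewrite /suffix rev_cons revK.
  have /prefixP[t ->] := pj.
  by apply/infixP; exists s, t; rewrite !rcons_cat /= -!catA.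
(* Assuming a nonzero value puts the central word in [S], as [acS] requires. *)
apply: contrapT => Phi_ab; have /suppPhi Sab := introN eqP Phi_ab; apply: Phi_ab.
apply: (@acyclic_no_circulation _ S (rev p ++ w ++ q)
          (fun c d => Phi (rcons p c) (rcons q d))) => //.
- apply: acS; apply: (facS _ _ Sab).
  by apply/infixP; exists [:: a], [:: b]; rewrite -cats1.
- move=> c; under eq_bigr do rewrite PhiC.
  apply: sum_prefix_rcons => //.
  by rewrite -PhiC IHn // size_rcons addSn.
- move=> d; apply: (@sum_prefix_rcons _ _ (fun i => rev (g i))) => //.
  by apply: IHn; rewrite size_rcons addnS.
Qed.

Theorem theorem3p11 (A B : finType) (S X : set (seq A)) (f : seq B -> seq A)
    (hA : 0 < #|A|) (hS : acyclic_set S) (hXS : X `<=` S)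
    (hfin : finite_set X) (hX : bifix_code X) (hf : coding_morphism X f)
    (hbi : biextendable (f @^-1` S)) :
  acyclic_set (f @^-1` S).
Proof.
split=> // w _; apply: no_circulation_acyclic => phi supp row col.
have [[_ fM] [fX finj _]] := hf; have [_ Xpre Xsuf] := hX.
have fI i j : f [:: i] = f [:: j] -> i = j by apply: finj; rewrite inE.
have XfB i : X (f [:: i]) by apply: fX.
apply: (@bifix_no_circulation _ _ S (f w) (fun b => f [:: b])) => //.
- by move=> i j /Xpre-/(_ (XfB i) (XfB j)) /fI.
- by move=> i j /Xsuf-/(_ (XfB i) (XfB j)) /fI.
- by move=> i j /supp; rewrite /= -cat1s -cats1 !fM.
Qed.
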